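(* Any given $L\in\overline{\mathbb{Q}}(z)[\frac{d}{dz}]$ admits a solution for which $L$ is of minimal order over $\overline{\mathbb{Q}}(z)$.
   Context: An embedding of $\overline{\mathbb{Q}}$ into $\mathbb{C}$ is fixed, so that $\overline{\mathbb{Q}}$ is viewed as a sub-field of $\mathbb{C}$. A ''solution of $L$'' means a solution $y$ of the homogeneous linear differential equation $Ly(z)=0$, viewed as an element of a Picard-Vessiot extension of $Ly(z)=0$ over $\mathbb{C}(z)$; in particular, solutions may have complex, not necessarily algebraic, coefficients. $L$ is said to be of minimal order over $\overline{\mathbb{Q}}(z)$ for a solution $y$ of $L$ if $y$ is not a solution of any operator in $\overline{\mathbb{Q}}(z)[\frac{d}{dz}]\setminus\{0\}$ of order strictly less than the order of $L$ (for $L=0$ there is nothing to check). *)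

(* Defs.v *)
From HB Require Import structures.
From mathcomp Require Import all_boot all_order all_algebra all_field.
From mathcomp Require Import generic_quotient ring.
From mathcomp Require Import reals complex.

Set Implicit Arguments.
Unset Strict Implicit.
Unset Printing Implicit Defensive.

Import GRing.Theory.
Local Open Scope ring_scope.
Local Open Scope quotient_scope.

Notation "x %:F" := (FracField.tofrac x) (format "x %:F") : ring_scope.

(* [ratfun F] is the field F(z); the variable z is ['X%:F]. *)
Notation ratfun F := {fraction {poly F}}.

(* ['\n_(repr x)] and ['\d_(repr x)] are the numerator and the denominator of a
   chosen representative of x; [fracmapE] and [fracderE] show that the two
   definitions below do not depend on this choice. *)

Section RationalFunctions.
Variable F : fieldType.
Implicit Types (x y : ratfun F) (p q : {poly F}).

Lemma fracE x : x = (\n_(repr x))%:F / (\d_(repr x))%:F.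
Proof.
have d0 : (\d_(repr x))%:F != 0 :> ratfun F by rewrite tofrac_eq0 denom_ratioP.
apply: (mulIf d0); rewrite divfK //.
rewrite -{1}[x]reprK; move: (repr x) => r.
rewrite /FracField.tofrac; unlock; rewrite -[LHS]FracField.pi_mul.
apply/eqmodP; rewrite /= FracField.equivfE /FracField.mulf.
by rewrite !numden_Ratio ?mulf_neq0 ?oner_eq0 ?denom_ratioP // !mulr1 mulrC.
Qed.

Lemma frac_crossE p q x : q != 0 -> x = p%:F / q%:F ->
  p * \d_(repr x) = \n_(repr x) * q.
Proof.
have := fracE x; have := denom_ratioP (repr x).
move: (\n_(repr x)) (\d_(repr x)) => a b /[swap] -> b0 q0 /esym/eqP.
by rewrite eqr_div ?tofrac_eq0 // -!rmorphM tofrac_eq => /eqP.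
Qed.

(* The derivation d/dz of F(z). *)
Definition fracder x : ratfun F :=
  let p := \n_(repr x) in let q := \d_(repr x) in
  (p^`() * q - p * q^`())%:F / (q ^+ 2)%:F.

Lemma fracderE p q : q != 0 ->
  fracder (p%:F / q%:F) = (p^`() * q - p * q^`())%:F / (q ^+ 2)%:F.
Proof.
move=> q0; set x := p%:F / q%:F; rewrite /fracder.
have := frac_crossE q0 (erefl x).
have := denom_ratioP (repr x).
move: (\n_(repr x)) (\d_(repr x)) => a b b0 E.
have {}b0 : b != 0 by [].
apply/eqP; rewrite eqr_div ?tofrac_eq0 ?expf_neq0 // -!rmorphM tofrac_eq.
have E' : p^`() * b + p * b^`() = a^`() * q + a * q^`().
  by rewrite -!derivM E.
rewrite -subr_eq0; apply/eqP.
have -> : (a^`() * b - a * b^`()) * q ^+ 2 - (p^`() * q - p * q^`()) * b ^+ 2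
  = (a^`() * q + a * q^`() - (p^`() * b + p * b^`())) * (b * q)
    + (q * b^`() + b * q^`()) * (p * b - a * q) by ring.
by rewrite E E' !subrr mul0r mulr0 addr0.
Qed.

Lemma fracder_tofrac p : fracder p%:F = (p^`())%:F.
Proof.
have -> : p%:F = p%:F / 1%:F :> ratfun F by rewrite rmorph1 divr1.
rewrite fracderE ?oner_eq0 // expr1n rmorph1 divr1 -[1]polyC1 derivC.
by rewrite mulr1 mulr0 subr0.
Qed.

End RationalFunctions.

(* The embedding F(z) -> E(z) induced by an embedding f : F -> E. *)
Section FracMap.
Variables (F E : fieldType) (f : {rmorphism F -> E}).

Definition fracmap (x : ratfun F) : ratfun E :=
  (map_poly f \n_(repr x))%:F / (map_poly f \d_(repr x))%:F.

Lemma fracmapE p q : q != 0 ->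
  fracmap (p%:F / q%:F) = (map_poly f p)%:F / (map_poly f q)%:F.
Proof.
move=> q0; have := frac_crossE q0 (erefl (p%:F / q%:F)); rewrite /fracmap => H.
apply/eqP; rewrite eqr_div ?tofrac_eq0 ?map_poly_eq0 ?denom_ratioP //.
by rewrite -!rmorphM H.
Qed.

Lemma fracmap_is_zmod_morphism : zmod_morphism fracmap.
Proof.
move=> x y; rewrite [x]fracE [y]fracE.
move: (denom_ratioP (repr x)) (denom_ratioP (repr y)).
move: (\n_(repr x)) (\d_(repr x)) (\n_(repr y)) (\d_(repr y)) => a b c d b0 d0.
have {}b0 : b != 0 by []. have {}d0 : d != 0 by [].
rewrite -mulNr -rmorphN addf_div ?tofrac_eq0 //.
rewrite -!rmorphM -rmorphD !fracmapE ?mulf_neq0 //.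
rewrite -[- (_ / _)]mulNr -rmorphN addf_div ?tofrac_eq0 ?map_poly_eq0 //.
by rewrite !(rmorphM, rmorphD, rmorphN) /=.
Qed.

Lemma fracmap_is_monoid_morphism : monoid_morphism fracmap.
Proof.
split=> [|x y].
  have -> : 1 = 1%:F / 1%:F :> ratfun F by rewrite rmorph1 divr1.
  by rewrite fracmapE ?oner_eq0 // !rmorph1 divr1.
rewrite [x]fracE [y]fracE.
move: (denom_ratioP (repr x)) (denom_ratioP (repr y)).
move: (\n_(repr x)) (\d_(repr x)) (\n_(repr y)) (\d_(repr y)) => a b c d b0 d0.
have {}b0 : b != 0 by []. have {}d0 : d != 0 by [].
rewrite mulf_div -!rmorphM !fracmapE ?mulf_neq0 // mulf_div.
by rewrite !rmorphM /=.
Qed.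

HB.instance Definition _ :=
  GRing.isZmodMorphism.Build (ratfun F) (ratfun E) fracmap
    fracmap_is_zmod_morphism.
HB.instance Definition _ :=
  GRing.isMonoidMorphism.Build (ratfun F) (ratfun E) fracmap
    fracmap_is_monoid_morphism.

End FracMap.

(* An operator sum_i a_i (d/dz)^i in F(z)[d/dz] is encoded by the polynomial
   with coefficients a_i: its order is the degree of that polynomial, and
   comparing orders amounts to comparing sizes, the zero operator (size 0)
   being below all others.  The product of {poly _} is not the composition of
   operators and plays no role here. *)
Notation diffop F := {poly (ratfun F)}.

Section DifferentialExtensions.
Variables (C K : fieldType) (e : {rmorphism ratfun C -> K}) (D : K -> K).

Definition is_derivation : Prop :=
  (forall x y, D (x + y) = D x + D y) /\
  (forall x y, D (x * y) = D x * y + x * D y).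

(* (K, D) is a differential field extension of (C(z), d/dz) through e. *)
Definition diff_extension : Prop :=
  is_derivation /\ (forall x : ratfun C, D (e x) = e (fracder x)).

Definition cst (c : C) : K := e (c%:P)%:F.

Definition diffop_app (L : diffop C) (y : K) : K :=
  \sum_(i < size L) e L`_i * iter i D y.

Definition is_solution (L : diffop C) (y : K) : Prop := diffop_app L y = 0.

Definition lin_indep_cst n (y : 'I_n -> K) : Prop :=
  forall c : 'I_n -> C, \sum_i cst (c i) * y i = 0 -> forall i, c i = 0.

Definition fundamental_system (L : diffop C) (y : 'I_(size L).-1 -> K) : Prop :=
  (forall i, is_solution L (y i)) /\ lin_indep_cst y.

Definition diff_subfield (P : K -> Prop) : Prop :=
  [/\ forall f, P (e f),
      forall x y, P x -> P y -> P (x - y),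
      forall x y, P x -> P y -> P (x * y),
      forall x, P x -> P x^-1
    & forall x, P x -> P (D x)].

(* K = C(z)<y_1, ..., y_n> as a differential field *)
Definition diff_generated n (y : 'I_n -> K) : Prop :=
  forall P : K -> Prop, diff_subfield P -> (forall i, P (y i)) ->
  forall x, P x.

(* For L = 0, [fundamental_system] is about the empty family, so that the
   extension is C(z) itself. *)
Definition picard_vessiot (L : diffop C) : Prop :=
  [/\ diff_extension,
      forall x, D x = 0 -> exists c, x = cst c
    & exists2 y, fundamental_system (L := L) y & diff_generated y].

End DifferentialExtensions.

Definition extend_diffop (F C : fieldType) (iota : {rmorphism F -> C})
  (L : diffop F) : diffop C := map_poly (fracmap iota) L.

Definition minimal_order_for (F C K : fieldType) (iota : {rmorphism F -> C})
    (e : {rmorphism ratfun C -> K}) (D : K -> K) (L : diffop F) (y : K) : Prop :=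
  forall M : diffop F, M != 0 -> (size M < size L)%N ->
    ~ is_solution e D (extend_diffop iota M) y.

(* Main.v *)
Require Import Defs.
From mathcomp Require Import all_boot all_order all_algebra all_field.
From mathcomp Require Import reals complex.
From mathcomp Require Import boolp classical_sets cardinality lebesgue_measure.

Import GRing.Theory.
Local Open Scope ring_scope.

(** Assume L nonzero, as no operator has smaller order than the zero operator.
    The solutions of L in a Picard-Vessiot extension form a complex vector space
    of dimension n, the order of L, whereas a nonzero operator M of smaller
    order has too few solutions to contain it
    ([exists_not_solution_of_low_order]): the solutions of L killed by M form a
    proper subspace.  There are only countably many operators with algebraic
    coefficients ([countable_diffop]), and countably many proper subspaces
    cannot cover a complex vector space.

    The covering argument is carried out on a moment curve.  Let y_0, ...,
    y_(n-1) be a fundamental system and put y(t) = sum_i t^i y_i for t real.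
    Since M is linear over the constants, M(y(t)) = sum_i t^i M(y_i) is a
    polynomial in t with coefficients in K, not all zero, hence it vanishes for
    finitely many t only ([finite_moment_solutions]).  The values of t
    that are bad for some M are thus countably many, and as the real line is
    uncountable some y(t) is a solution of no M of smaller order.

    The bound on the number of solutions is the classical Wronskian argument
    ([common_equation_dependent]): functions that outnumber the order of an
    equation which they all satisfy are linearly dependent over the
    constants. *)

Section ConstantLinearity.
Variables (K : fieldType) (D : K -> K).
Hypothesis derD : is_derivation D.

Lemma derivation0 : D 0 = 0.
Proof. by apply: (addIr (D 0)); rewrite -derD.1 !add0r. Qed.

Lemma derivation1 : D 1 = 0.
Proof. by apply: (addIr (D 1)); rewrite -{3}[1]mul1r derD.2 mulr1 mul1r add0r. Qed.

Lemma derivation_sum I (r : seq I) (f : I -> K) :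
  D (\sum_(i <- r) f i) = \sum_(i <- r) D (f i).
Proof. exact: (big_morph D derD.1 derivation0). Qed.

Lemma iter_derivation_lin n (c y : 'I_n -> K) j : (forall i, D (c i) = 0) ->
  iter j D (\sum_i c i * y i) = \sum_i c i * iter j D (y i).
Proof.
move=> Dc; elim: j => [//|j IHj]; rewrite iterS IHj derivation_sum.
by apply: eq_bigr => i _; rewrite derD.2 Dc mul0r add0r.
Qed.

(** The vectors c with sum_i c_i y_i^(j) = 0 for all j < m form a nonzero space,
    having n > m unknowns for m equations.  The differential equation extends
    these relations to j = m, so that differentiating a relation of rank j < m
    shows that the space is stable under D.  If such a vector c is scaled to
    have an entry equal to 1, then D c has strictly smaller support; hence a
    vector whose support is minimal is made of constants after scaling. *)
Lemma common_equation_dependent n m (y : 'I_n -> K) (a : nat -> K) :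
    (m < n)%N -> a m != 0 ->
    (forall i, \sum_(j < m.+1) a j * iter j D (y i) = 0) ->
  exists c : 'I_n -> K,
    [/\ forall i, D (c i) = 0, exists i, c i != 0 & \sum_i c i * y i = 0].
Proof.
move=> ltmn am0 ay0.
pose P (c : 'I_n -> K) :=
  forall j, (j < m)%N -> \sum_i c i * iter j D (y i) = 0.
have P_m c : P c -> forall j, (j <= m)%N -> \sum_i c i * iter j D (y i) = 0.
  move=> Pc j; rewrite leq_eqVlt => /predU1P[->|/Pc//].
  apply: (mulfI am0); rewrite mulr0 mulr_sumr.
  transitivity (\sum_i c i * \sum_(k < m.+1) a k * iter k D (y i)); last first.
    by apply: big1 => i _; rewrite ay0 mulr0.
  under [RHS]eq_bigr => i _ do rewrite big_ord_recr mulrDr /= mulr_sumr.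
  rewrite big_split /= exchange_big /= [X in _ = X + _]big1 ?add0r => [|k _].
    by apply: eq_bigr => i _; rewrite mulrCA.
  under eq_bigr => i _ do rewrite mulrCA.
  by rewrite -mulr_sumr Pc ?mulr0.
have P_D c : P c -> P (D \o c).
  move=> Pc j ltjm; have := congr1 D (Pc j ltjm).
  rewrite derivation0 derivation_sum.
  under eq_bigr => i _ do rewrite derD.2 -iterS.
  by rewrite big_split /= (P_m c Pc j.+1 ltjm) addr0.
have P_Z c b : P c -> P (fun i => b * c i).
  move=> Pc j ltjm; under eq_bigr => i _ do rewrite -mulrA.
  by rewrite -mulr_sumr Pc ?mulr0.
have [c Pc c0] : exists2 c, P c & exists i, c i != 0.
  pose W := \matrix_(i < n, j < m) iter j D (y i).
  have kerW0 : kermx W != 0.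
    rewrite -mxrank_eq0 mxrank_ker -lt0n subn_gt0.
    exact: leq_ltn_trans (rank_leq_col W) ltmn.
  exists (nz_row (kermx W) 0) => [j ltjm|].
    have /sub_kermxP/matrixP/(_ 0 (Ordinal ltjm)) := nz_row_sub (kermx W).
    move=> vW0; transitivity ((nz_row (kermx W) *m W) 0 (Ordinal ltjm)).
      by rewrite mxE; apply: eq_bigr => i _; rewrite [W _ _]mxE.
    by rewrite vW0 mxE.
  by apply/rV0Pn; rewrite nz_row_eq0.
have [s] := ubnP #|[pred i | c i != 0]|.
elim: s => // s IHs in c Pc c0 *; rewrite ltnS => les.
case: c0 => k ck0; pose c1 i := (c k)^-1 * c i.
have Pc1 : P c1 by exact: P_Z.
have c1k : c1 k = 1 by rewrite /c1 mulVf.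
have [/existsP Dc1|/existsPn Dc1] := boolP [exists i, D (c1 i) != 0].
  apply: (IHs (D \o c1)) => //; first exact: P_D.
  apply: leq_trans les; apply: proper_card; apply/properP; split.
    apply/fintype.subsetP => i; rewrite !inE /=; apply: contraNneq => ci0.
    by rewrite /c1 ci0 mulr0 derivation0.
  by exists k; rewrite !inE //= c1k derivation1 eqxx.
(* For m = 0 the relation sum_i c_i y_i = 0 is not part of P: it comes from the
   differential equation. *)
exists c1; split; last exact: (P_m _ Pc1 0%N).
  by move=> i; have := Dc1 i; rewrite negbK => /eqP.
by exists k; rewrite c1k oner_eq0.
Qed.

End ConstantLinearity.

Section Solutions.
Variables (C K : fieldType) (e : {rmorphism ratfun C -> K}) (D : K -> K).
Hypothesis extD : diff_extension e D.

Lemma cstX (t : C) n : cst e (t ^+ n) = cst e t ^+ n.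
Proof. by rewrite /cst !rmorphXn. Qed.

Lemma cst_inj : injective (cst e).
Proof. by move=> s t /fmorph_inj/eqP; rewrite tofrac_eq => /eqP/polyC_inj. Qed.

Lemma cst_der (t : C) : D (cst e t) = 0.
Proof. by rewrite extD.2 fracder_tofrac derivC !rmorph0. Qed.

Lemma diffop_app_lin n (M : diffop C) (c : 'I_n -> C) (y : 'I_n -> K) :
  diffop_app e D M (\sum_i cst e (c i) * y i) =
    \sum_i cst e (c i) * diffop_app e D M (y i).
Proof.
rewrite /diffop_app; under [RHS]eq_bigr => i _ do rewrite mulr_sumr.
rewrite exchange_big /=; apply: eq_bigr => j _.
rewrite (iter_derivation_lin _ _ extD.1) => [|i]; last exact: cst_der.
by rewrite mulr_sumr; apply: eq_bigr => i _; rewrite mulrCA.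
Qed.

(** A dependence relation with coefficients killed by D is one over C, because
    the extension has no new constants. *)
Lemma exists_not_solution_of_low_order n (y : 'I_n -> K) (M : diffop C) :
    (forall x, D x = 0 -> exists c, x = cst e c) -> lin_indep_cst e y ->
    M != 0 -> (size M <= n)%N ->
  exists i, diffop_app e D M (y i) != 0.
Proof.
move=> cstD indy M0 leMn; apply/existsP; apply: contraT => /existsPn My0.
have szM : (size M).-1.+1 = size M by rewrite prednK // size_poly_gt0.
have [|||c [Dc [k ck0] cy0]] :=
    @common_equation_dependent _ D extD.1 n (size M).-1 y (fun j => e M`_j).
- by rewrite szM.
- by rewrite fmorph_eq0 -lead_coefE lead_coef_eq0.
- by move=> i; rewrite szM; have := My0 i; rewrite negbK => /eqP.
have [b cE] := choice (fun i => cstD _ (Dc i)).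
have b0 : b k = 0.
  by apply: indy; rewrite -[RHS]cy0; apply: eq_bigr => i _; rewrite cE.
by rewrite cE b0 /cst !rmorph0 eqxx in ck0.
Qed.

(** On the moment curve, the condition M(y(t)) = 0 says that [cst e (f t)] is a
    root of the polynomial sum_i M(y_i) X^i over K, and t is determined by
    [cst e (f t)].  The map f restricts the parameter to part of C, such as
    the real line in the field of complex numbers. *)
Lemma finite_moment_solutions (T : choiceType) (f : T -> C) n (y : 'I_n -> K)
    (M : diffop C) :
    injective f -> (exists i, diffop_app e D M (y i) != 0) ->
  finite_set [set t | is_solution e D M (\sum_(i < n) cst e (f t ^+ i) * y i)].
Proof.
move=> f_inj [k Myk0]; apply: contrapT => infS.
pose p : {poly K} := \poly_(i < n) oapp (fun j => diffop_app e D M (y j)) 0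
  (insub i).
have p0 : p != 0.
  apply: contraNneq Myk0 => /(congr1 (coefp k)).
  by rewrite /= coef_poly ltn_ord valK /= coef0 => ->.
have [B BS leB] := infinite_set_fset (size p) infS.
(* More than deg p distinct parameters would give too many roots of p. *)
suff: (size (finmap.enum_fset B) < size p)%N by rewrite ltnNge leB.
rewrite -(size_map (cst e \o f)); apply: max_poly_roots => //.
  apply/allP => _ /mapP[t tB ->]; have := BS t tB.
  rewrite /= /is_solution diffop_app_lin => St.
  rewrite rootE horner_poly -[X in _ == X]St; apply/eqP.
  by apply: eq_bigr => i _; rewrite valK /= cstX mulrC.
by rewrite map_inj_uniq ?finmap.fset_uniq // => s t /cst_inj/f_inj.
Qed.

End Solutions.

(** An operator is recovered from the finite sequence of the numerators and
    denominators of its coefficients. *)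
Lemma countable_diffop (F : countFieldType) : countable [set: diffop F]%classic.
Proof.
pose dec (s : seq ({poly F} * {poly F})) : diffop F :=
  Poly [seq u.1%:F / u.2%:F | u <- s].
apply: sub_countable (countableP [set: seq ({poly F} * {poly F})]%classic).
suff -> : [set: diffop F]%classic = (dec @` setT)%classic by exact: card_image_le.
apply/seteqP; split=> // M _.
exists [seq (\n_(repr x), \d_(repr x)) | x <- M] => //.
rewrite /dec -map_comp -[RHS]polyseqK; congr Poly.
by rewrite -[RHS]map_id; apply: eq_map => x /=; rewrite -fracE.
Qed.

(** A countable set is Lebesgue-null, but the unit interval has measure 1. *)
Lemma uncountable_real (R : realType) : ~ countable [set: R]%classic.
Proof.
move=> cR; have c01 : countable `[0 : R, 1]%classic.
  exact: sub_countable (subset_card_le (@subsetT _ _)) cR.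
have := etrans (esym (countable_lebesgue_measure0 c01))
  (lebesgue_measure_itv `[0 : R, 1]).
rewrite /= constructive_ereal.lte_fin Num.Theory.ltr01.
by move=> -[] /eqP; rewrite oppr0 addr0 eq_sym oner_eq0.
Qed.

Theorem proposition5 (R : realType) (iota : {rmorphism algC -> R[i]})
    (L : diffop algC)
    (K : fieldType) (e : {rmorphism ratfun R[i] -> K}) (D : K -> K)
    (hK : picard_vessiot e D (extend_diffop iota L)) :
  exists y : K, is_solution e D (extend_diffop iota L) y /\
    minimal_order_for iota e D L y.
Proof.
have [extD cstD [y [soly indy] _]] := hK.
have szE (M : diffop algC) : size (extend_diffop iota M) = size M.
  exact: size_map_poly.
pose n := (size (extend_diffop iota L)).-1.
pose yt (t : R) := \sum_(i < n) cst e (t%:C%C ^+ i) * y i.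
pose low (M : diffop algC) := M != 0 /\ (size M < size L)%N.
pose bad M := [set t | is_solution e D (extend_diffop iota M) (yt t)]%classic.
have [t tP] : exists t, ~ (\bigcup_(M in low) bad M)%classic t.
  apply/not_existsP => badT; apply: (@uncountable_real R).
  rewrite (_ : [set: R]%classic = (\bigcup_(M in low) bad M)%classic); last first.
    by apply/seteqP; split=> // t _; exact: contrapT.
  apply: bigcup_countable => [|M [M0 ltML]].
    exact: sub_countable (subset_card_le (@subsetT _ _)) (countable_diffop _).
  apply: finite_set_countable; apply: finite_moment_solutions => //.
    exact: fmorph_inj.
  apply: exists_not_solution_of_low_order => //; first by rewrite map_poly_eq0.
  by rewrite szE /n szE -ltnS prednK //; exact: leq_trans ltML.
exists (yt t); split=> [|M M0 ltML solM]; last by apply: tP; exists M.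
rewrite /is_solution diffop_app_lin //; apply: big1 => i _.
by rewrite (soly i) mulr0.
Qed.
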